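(* Let $n\ge1$ and let $M_n$ be the finite quantum space given by the algebra $C(M_n)=M_n(\mathbb{C})$ of all $n\times n$ matrices with counit $\eta^\dagger=n\,\mathrm{Tr}$ (so that $\delta^2=\eta^\dagger\eta=n^2$). Then the transposition $a\mapsto a^{T}$, taken as a linear map $l^2(M_n)\to l^2(M_n)$, is a normalized quantum Hadamard matrix; that is, the map $H(a)=n\,a^{T}$ is a quantum Hadamard matrix on $M_n$.
   Context: A finite quantum space $X$ is a special Frobenius $*$-algebra $C(X)$: a finite-dimensional unital $*$-algebra over $\mathbb{C}$ with multiplication $m\colon C(X)\otimes C(X)\to C(X)$, unit $\eta\colon\mathbb{C}\to C(X)$, $1\mapsto 1_{C(X)}$, and a positive functional $\psi$ such that $(a,b)\mapsto\psi(ab)$ is non-degenerate and such that $mm^\dagger=\mathrm{id}$, where $\dagger$ denotes the adjoint with respect to the inner product $\langle a,b\rangle=\psi(a^*b)$. Then $\psi=\eta^\dagger$. The Hilbert space obtained is $l^2(X)$. Put $\delta^2:=\eta^\dagger\eta$ and $R:=m^\dagger\eta\colon\mathbb{C}\to l^2(X)\otimes l^2(X)$, so that $R^\dagger=\eta^\dagger m$. For linear maps $A,B\colon l^2(X)\to l^2(X)$ put $A^*:=(\mathrm{id}\otimes R^\dagger)(\mathrm{id}\otimes A^\dagger\otimes\mathrm{id})(R\otimes\mathrm{id})$ and $A\bullet B:=m(A\otimes B)m^\dagger$. A quantum Hadamard matrix on $X$ is a linear map $H\colon l^2(X)\to l^2(X)$ such that $H=H^*$, $H\bullet H=\eta\eta^\dagger$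 and $HH^\dagger=\delta^2\,\mathrm{id}=H^\dagger H$. Normalized means divided by $\delta$. *)

(* Defs.v *)
From HB Require Import structures.
From mathcomp Require Import all_boot all_order all_algebra all_field.
From mathcomp Require Import boolp classical_sets.

Set Implicit Arguments.
Unset Strict Implicit.
Unset Printing Implicit Defensive.

Import Order.TTheory GRing.Theory Num.Theory.
Import VectorInternalTheory.

Local Open Scope ring_scope.

Section Tensor.
Variable C : numClosedFieldType.

(* A finite-dimensional vector space with a pairing, written in the physicists'
   order: antilinear in the first argument, linear in the second. Positivity is
   not part of the structure; for the space l2 X below it follows from the
   axioms [is_finite_quantum_space], and tensor products inherit it. *)
Record ipSpace := IpSpace {
  ip_vect :> vectType C;
  ip : ip_vect -> ip_vect -> C
}.

Definition scalarSpace : ipSpace :=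
  @IpSpace C^o (fun x y : C => x^* * y).

(* The vector of V whose coordinates in the canonical basis of V are all zero
   but the i-th, which is 1. *)
Definition basisv (V : vectType C) (i : 'I_(dim V)) : V :=
  r2v (delta_mx 0 i).

(* V (x) W, encoded by matrices of coordinates in the products of canonical
   basis vectors, with the pairing such that
   <v1 (x) w1, v2 (x) w2> = <v1, v2> <w1, w2>. *)
Definition tensor_ip (V W : ipSpace) (S T : 'M[C]_(dim V, dim W)) : C :=
  \sum_i \sum_j \sum_k \sum_l
    (S i j)^* * T k l * (ip (basisv i : V) (basisv k)
                       * ip (basisv j : W) (basisv l)).

Definition tensor (V W : ipSpace) : ipSpace :=
  IpSpace (@tensor_ip V W).

Definition pure (V W : ipSpace) (v : V) (w : W) : tensor V W :=
  (v2r v)^T *m v2r w.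

(* The linear map V (x) W -> U induced by a bilinear map b. *)
Definition tensor_lift (V W : ipSpace) (U : vectType C) (b : V -> W -> U) :
    'Hom(tensor V W, U) :=
  linfun (fun T : 'M[C]_(dim V, dim W) =>
            \sum_i \sum_j T i j *: b (basisv i) (basisv j)).

Definition tensor_map (V1 V2 W1 W2 : ipSpace)
    (f : 'Hom(V1, W1)) (g : 'Hom(V2, W2)) :
    'Hom(tensor V1 V2, tensor W1 W2) :=
  @tensor_lift V1 V2 (tensor W1 W2) (fun v w => pure (f v) (g w)).

Definition tensor_assoc (U V W : ipSpace) :
    'Hom(tensor (tensor U V) W, tensor U (tensor V W)) :=
  @tensor_lift (tensor U V) W (tensor U (tensor V W)) (fun S w =>
    @tensor_lift U V (tensor U (tensor V W))
      (fun u v => pure u (pure v w)) S).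

Definition tensor_lunit_inv (V : ipSpace) : 'Hom(V, tensor scalarSpace V) :=
  linfun (fun v : V => pure (1 : scalarSpace) v).

Definition tensor_runit (V : ipSpace) : 'Hom(tensor V scalarSpace, V) :=
  @tensor_lift V scalarSpace V (fun v (z : C) => z *: v).

(* The adjoint with respect to the given pairings (unique as soon as the
   pairing of V is non-degenerate; 0 if there is none). *)
Definition adj (V W : ipSpace) (f : 'Hom(V, W)) : 'Hom(W, V) :=
  xget 0 [set g : 'Hom(W, V) | forall (v : V) (w : W),
            ip (f v) w = ip v (g w)].

End Tensor.

Section QuantumSpace.
Variable C : numClosedFieldType.

Record starAlg := StarAlg {
  salg : falgType C;
  star : salg -> salg;
  counit : {scalar salg}
}.

Definition l2 (X : starAlg) : ipSpace C :=
  @IpSpace C (salg X) (fun a b : salg X => counit X (star a * b)).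

Definition qmul (X : starAlg) : 'Hom(tensor (l2 X) (l2 X), l2 X) :=
  @tensor_lift C (l2 X) (l2 X) (l2 X) (fun a b : salg X => a * b).

Definition qunit (X : starAlg) : 'Hom(scalarSpace C, l2 X) :=
  linfun (fun z : C^o => z *: (1 : salg X)).

Record is_finite_quantum_space (X : starAlg) : Prop := IsFiniteQuantumSpace {
  star_antilinear : forall (z : C) (a b : salg X),
    star (z *: a + b) = z^* *: star a + star b;
  star_involutive : forall a : salg X, star (star a) = a;
  star_antimul : forall a b : salg X, star (a * b) = star b * star a;
  counit_ge0 : forall a : salg X, 0 <= counit X (star a * a);
  counit_nondegl : forall a : salg X,
    (forall b : salg X, counit X (a * b) = 0) -> a = 0;
  counit_nondegr : forall b : salg X,
    (forall a : salg X, counit X (a * b) = 0) -> b = 0;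
  qmul_special : (qmul X \o adj (qmul X))%VF = \1%VF
}.

(* eta^dagger eta is a linear endomorphism of C, that is, the multiplication
   by its value at 1. *)
Definition delta2 (X : starAlg) : C :=
  (adj (qunit X) \o qunit X)%VF 1.

Definition qR (X : starAlg) : 'Hom(scalarSpace C, tensor (l2 X) (l2 X)) :=
  (adj (qmul X) \o qunit X)%VF.

Definition qconj (X : starAlg) (A : 'Hom(l2 X, l2 X)) : 'Hom(l2 X, l2 X) :=
  let id_ := \1%VF : 'Hom(l2 X, l2 X) in
  (tensor_runit (l2 X)
   \o (tensor_map id_ (adj (qR X))
   \o (tensor_assoc (l2 X) (l2 X) (l2 X)
   \o (tensor_map (tensor_map id_ (adj A)) id_
   \o (tensor_map (qR X) id_
   \o tensor_lunit_inv (l2 X))))))%VF.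

Definition schur (X : starAlg) (A B : 'Hom(l2 X, l2 X)) : 'Hom(l2 X, l2 X) :=
  (qmul X \o (tensor_map A B \o adj (qmul X)))%VF.

Definition is_qHadamard (X : starAlg) (H : 'Hom(l2 X, l2 X)) : Prop :=
  [/\ H = qconj H,
      schur H H = (qunit X \o adj (qunit X))%VF,
      (H \o adj H)%VF = delta2 X *: \1%VF &
      delta2 X *: \1%VF = (adj H \o H)%VF].

Definition is_normalized_qHadamard (X : starAlg) (U : 'Hom(l2 X, l2 X)) :
    Prop :=
  exists2 H : 'Hom(l2 X, l2 X),
    is_qHadamard H & U = (sqrtC (delta2 X))^-1 *: H.

Definition mat_counit (n : nat) (a : 'M[C]_n.+1) : C := n.+1%:R * \tr a.

Fact mat_counit_is_scalar (n : nat) : scalar (@mat_counit n).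
Proof.
by move=> z a b; rewrite /mat_counit linearP mulrDr mulrCA.
Qed.

HB.instance Definition _ (n : nat) :=
  GRing.isLinear.Build C 'M[C]_n.+1 C *%R (@mat_counit n)
    (@mat_counit_is_scalar n).

(* n.+1 x n.+1 matrices, so that the size ranges over the positive integers. *)
Definition matAlg (n : nat) : starAlg :=
  @StarAlg 'M[C]_n.+1
    (fun a : 'M[C]_n.+1 => map_mx Num.conj a^T) (@mat_counit n).

End QuantumSpace.

(* Main.v *)
Require Import Defs.
From HB Require Import structures.
From mathcomp Require Import all_boot all_order all_algebra all_field.
From mathcomp Require Import boolp classical_sets.
From mathcomp Require Import reals complex.

Set Implicit Arguments.
Unset Strict Implicit.
Unset Printing Implicit Defensive.

Import GRing.Theory Num.Theory VectorInternalTheory.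
Local Open Scope ring_scope.

(** Write N for the size of the matrices and e_ij for the matrix units. For
    the inner product <a, b> = N Tr(a^* b) the adjoint of the multiplication is
<<
      m^dagger(a) = N^-1 sum_(p,k) a e_pk (x) e_kp,
>>
    and the adjoint of the unit is N Tr. With these two formulas every axiom
    becomes an identity between matrix units. Specialness holds because
    N^-1 sum_(p,k) a e_pk e_kp = a, and, for the self-adjoint map
    H = N (transposition):
    - R = m^dagger(1) is the flip tensor N^-1 sum e_pk (x) e_kp and
      R^dagger(x (x) y) = N Tr(x y); so H^* sends a to
      N^-1 sum_(p,k) N Tr(H(e_kp) a) e_pk = H(a) (lemma [qconj_mat_tr]);
    - H . H sends a to N^-1 sum_(p,k) N^2 (a e_pk)^T (e_kp)^T
      = N sum_(p,k) e_kp a^T e_pk = N Tr(a) 1, which is eta eta^dagger(a)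
      (lemma [schur_mat_tr]);
    - H H = N^2 id, because transposition is an involution, and
      delta^2 = N Tr(1) = N^2.

    The tensor products are coordinate matrices and the adjoint is obtained by
    choice, so the computation needs two tools: evaluation of all tensor
    operations on pure tensors ([tensor_lift_pure] and its consequences), and
    uniqueness of the adjoint ([adj_eq]), which for m requires that the tensor
    product of two non-degenerate Hermitian forms be non-degenerate
    ([tensor_inner]). *)

Section LinearAlgebra.
Variable C : numClosedFieldType.

(** * Linear maps and coordinates *)

Lemma linear_sumZ (V U : lmodType C) (f : V -> U) I (r : seq I) (c : I -> C)
    (x : I -> V) : linear f ->
  f (\sum_(i <- r) c i *: x i) = \sum_(i <- r) c i *: f (x i).
Proof.
move=> fL; pose g : {linear V -> U} :=
  HB.pack f (GRing.isLinear.Build C V U _ f fL).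
by rewrite -[f]/(g : V -> U) linear_sum; apply: eq_bigr => i _; rewrite linearZ.
Qed.

Lemma linfun_apply (V U : vectType C) (f : V -> U) : linear f -> linfun f =1 f.
Proof.
move=> fL; pose g : {linear V -> U} :=
  HB.pack f (GRing.isLinear.Build C V U _ f fL).
by move=> x; rewrite -[f]/(g : V -> U) lfunE.
Qed.

Lemma lfun_sumZ (V U : vectType C) (f : 'Hom(V, U)) I (r : seq I) (c : I -> C)
    (x : I -> V) :
  f (\sum_(i <- r) c i *: x i) = \sum_(i <- r) c i *: f (x i).
Proof. exact: linear_sumZ (linearP f). Qed.

Lemma basisv_sum (V : vectType C) (c : 'I_(dim V) -> C) :
  \sum_i c i *: basisv i = r2v (\row_i c i).
Proof.
rewrite [\row_i c i]row_sum_delta linear_sum; apply: eq_bigr => i _.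
by rewrite linearZ mxE.
Qed.

Lemma basisv_expand (V : vectType C) (v : V) :
  v = \sum_i v2r v 0 i *: basisv i.
Proof.
rewrite basisv_sum -[LHS]v2rK; congr r2v.
by apply/rowP => i; rewrite mxE.
Qed.

Lemma basisv_free (V : vectType C) (c : 'I_(dim V) -> C) :
  \sum_i c i *: basisv i = 0 -> forall i, c i = 0.
Proof.
rewrite basisv_sum => h i.
have /rowP/(_ i) : \row_i c i = 0 by apply: (can_inj r2vK); rewrite h linear0.
by rewrite !mxE.
Qed.

(** * Operations on pure tensors *)

Definition bilinear_map (V W U : lmodType C) (b : V -> W -> U) : Prop :=
  (forall v, linear (b v)) /\ (forall w, linear (b^~ w)).

(** The right-hand side is linear in the coordinates [T] for any function [b]. *)
Lemma tensor_liftE (V W : ipSpace C) (U : vectType C) (b : V -> W -> U)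
    (T : tensor V W) :
  tensor_lift b T = \sum_i \sum_j T i j *: b (basisv i) (basisv j).
Proof.
rewrite /tensor_lift linfun_apply // => z S S'.
rewrite scaler_sumr -big_split; apply: eq_bigr => i _ /=.
rewrite scaler_sumr -big_split; apply: eq_bigr => j _ /=.
by rewrite !mxE scalerDl scalerA.
Qed.

Lemma pure_bilinear (V W : ipSpace C) : bilinear_map (@pure C V W).
Proof.
split=> [v|w] z x y; rewrite /pure linearP.
  by rewrite mulmxDr -scalemxAr.
by rewrite linearP mulmxDl -scalemxAl.
Qed.

(** The universal property of the tensor product: coordinates of a pure tensor
    are products of coordinates, so bilinearity recombines both expansions. *)
Lemma tensor_lift_pure (V W : ipSpace C) (U : vectType C) (b : V -> W -> U) :
  bilinear_map b -> forall v w, tensor_lift b (pure v w) = b v w.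
Proof.
move=> [br bl] v w; rewrite tensor_liftE.
rewrite [in RHS](basisv_expand v) (linear_sumZ _ _ _ (bl w)).
apply: eq_bigr => i _.
rewrite [in RHS](basisv_expand w) (linear_sumZ _ _ _ (br _)) scaler_sumr.
apply: eq_bigr => j _.
by rewrite scalerA /pure mxE big_ord1 mxE.
Qed.

Lemma tensor_expand (V W : ipSpace C) (T : tensor V W) :
  T = \sum_(p : 'I_(dim V) * 'I_(dim W))
        T p.1 p.2 *: pure (basisv p.1 : V) (basisv p.2 : W).
Proof.
rewrite [LHS]matrix_sum_delta pair_bigA; apply: eq_bigr => -[i j] _ /=.
by rewrite /pure /basisv !r2vK trmx_delta mul_delta_mx.
Qed.

Lemma lfun_bilinear (V W U : vectType C) (V' W' : vectType C)
    (f : 'Hom(V, V')) (g : 'Hom(W, W')) (b : V' -> W' -> U) :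
  bilinear_map b -> bilinear_map (fun v w => b (f v) (g w)).
Proof.
by move=> [br bl]; split=> [v|w] z x y; rewrite linearP ?br //; apply: bl.
Qed.

Lemma tensor_map_pure (V1 V2 W1 W2 : ipSpace C)
    (f : 'Hom(V1, W1)) (g : 'Hom(V2, W2)) v w :
  tensor_map f g (pure v w) = pure (f v) (g w).
Proof.
by rewrite /tensor_map tensor_lift_pure //; apply/lfun_bilinear/pure_bilinear.
Qed.

Lemma tensor_assoc_pure (U V W : ipSpace C) (u : U) (v : V) (w : W) :
  tensor_assoc U V W (pure (pure u v) w) = pure u (pure v w).
Proof.
have [pr pl] := (pure_bilinear U (tensor V W)).
have [qr ql] := (pure_bilinear V W).
have bil (w' : W) : bilinear_map (fun (u : U) (v : V) => pure u (pure v w')).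
  by split=> [u'|v'] z x y; [rewrite /= ql pr | rewrite /= pl].
rewrite /tensor_assoc tensor_lift_pure ?tensor_lift_pure //.
split=> [S|w'] z x y; last by rewrite linearP.
rewrite !tensor_liftE scaler_sumr -big_split; apply: eq_bigr => i _ /=.
rewrite scaler_sumr -big_split; apply: eq_bigr => j _ /=.
by rewrite qr pr scalerDr !scalerA mulrC.
Qed.

Lemma tensor_lunit_invE (V : ipSpace C) (v : V) :
  tensor_lunit_inv V v = pure (1 : scalarSpace C) v.
Proof.
rewrite /tensor_lunit_inv linfun_apply //.
by case: (pure_bilinear (scalarSpace C) V).
Qed.

Lemma tensor_runit_pure (V : ipSpace C) (v : V) (z : C) :
  tensor_runit V (pure v (z : scalarSpace C)) = z *: v.
Proof.
rewrite /tensor_runit tensor_lift_pure //; split=> [v'|w'] c x y.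
  by rewrite scalerDl scalerA.
by rewrite scalerDr !scalerA mulrC.
Qed.

(** * Hermitian forms and adjoints *)

(** Non-degeneracy, rather than positivity, is what makes adjoints unique, and it
    passes to tensor products by freeness of the canonical bases alone. *)
Record is_inner (V : ipSpace C) : Prop := IsInner {
  ip_linear : forall v : V, scalar (ip v);
  ip_herm : forall v w : V, ip v w = (ip w v)^*;
  ip_nondeg : forall w : V, (forall v, ip v w = 0) -> w = 0
}.

Definition is_adjoint (V W : ipSpace C) (f : 'Hom(V, W)) (g : 'Hom(W, V)) :=
  forall v w, ip (f v) w = ip v (g w).

(** Two adjoints of [f] differ by a map whose values are orthogonal to V. *)
Lemma adj_eq (V W : ipSpace C) (f : 'Hom(V, W)) (g : 'Hom(W, V)) :
  is_inner V -> is_adjoint f g -> adj f = g.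
Proof.
move=> Vi fg; rewrite /adj.
apply: xget_unique => // h /= fh; apply/lfunP => w.
apply/eqP; rewrite -subr_eq0; apply/eqP/(ip_nondeg Vi) => v.
rewrite -[h w]scale1r -scaleN1r addrC (ip_linear Vi) scale1r.
by rewrite -fh -fg mulN1r addNr.
Qed.

Lemma is_adjoint_sym (V W : ipSpace C) (f : 'Hom(V, W)) (g : 'Hom(W, V)) :
  is_inner V -> is_inner W -> is_adjoint f g -> is_adjoint g f.
Proof. by move=> Vi Wi fg w v; rewrite (ip_herm Vi) -fg -(ip_herm Wi). Qed.

Lemma is_adjoint_comp (V W U : ipSpace C)
    (f : 'Hom(V, W)) g (f' : 'Hom(W, U)) g' :
  is_adjoint f g -> is_adjoint f' g' -> is_adjoint (f' \o f)%VF (g \o g')%VF.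
Proof. by move=> fg fg' v u; rewrite !comp_lfunE /= fg' fg. Qed.

Lemma ip_sumr (V : ipSpace C) (Vi : is_inner V) I (r : seq I) (c : I -> C)
   (x : I -> V) v :
  ip v (\sum_(i <- r) c i *: x i) = \sum_(i <- r) c i * ip v (x i).
Proof. by rewrite (@linear_sumZ V C^o) //; apply: ip_linear. Qed.

Lemma tensor_ip_pure (V W : ipSpace C) (v v' : V) (w w' : W) :
  is_inner V -> is_inner W ->
  ip (pure v w) (pure v' w') = ip v v' * ip w w'.
Proof.
move=> Vi Wi; rewrite /= /tensor_ip.
(* The form in coordinates, antilinear in x by Hermitian symmetry. *)
have ip_coord (U : ipSpace C) (Ui : is_inner U) (x y : U) :
   ip x y =
   \sum_i \sum_k (v2r x 0 i)^* * v2r y 0 k * ip (basisv i : U) (basisv k).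
  rewrite [in LHS](basisv_expand x) (ip_herm Ui) (ip_sumr Ui) rmorph_sum.
  apply: eq_bigr => i _ /=.
  rewrite rmorphM /= -(ip_herm Ui) [in LHS](basisv_expand y) (ip_sumr Ui).
  rewrite mulr_sumr.
  by apply: eq_bigr => k _; rewrite mulrA.
rewrite (ip_coord _ Vi v) (ip_coord _ Wi w) mulr_suml; apply: eq_bigr => i _.
rewrite mulr_sumr; apply: eq_bigr => j _.
rewrite mulr_suml; apply: eq_bigr => k _.
rewrite mulr_sumr; apply: eq_bigr => l _.
by rewrite /pure !mxE !big_ord1 !mxE rmorphM /= [X in X * _]mulrACA [LHS]mulrACA.
Qed.

Lemma exchange_big4 (I J K L : finType) (F : I -> J -> K -> L -> C) :
  \sum_i \sum_j \sum_k \sum_l F i j k l =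
  \sum_k \sum_l \sum_i \sum_j F i j k l.
Proof.
under eq_bigr do rewrite exchange_big; rewrite exchange_big /=.
apply: eq_bigr => k _.
by under eq_bigr do rewrite exchange_big; rewrite exchange_big.
Qed.

(** For non-degeneracy, let T be orthogonal to all pure tensors v (x) w. As w
    varies, non-degeneracy of W and freeness of its basis give
    <v, sum_k T_kl b_k> = 0 for each l; as v varies, the same argument in V
    gives T_kl = 0. *)
Lemma tensor_inner (V W : ipSpace C) :
  is_inner V -> is_inner W -> is_inner (tensor V W).
Proof.
move=> Vi Wi; have lin S : scalar (@tensor_ip C V W S).
  move=> z T T'; rewrite /tensor_ip mulr_sumr -big_split.
  apply: eq_bigr => i _ /=.
  rewrite mulr_sumr -big_split; apply: eq_bigr => j _ /=.
  rewrite mulr_sumr -big_split; apply: eq_bigr => k _ /=.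
  rewrite mulr_sumr -big_split; apply: eq_bigr => l _ /=.
  by rewrite !mxE mulrDr mulrDl (mulrCA _ z) -(mulrA z).
split=> //.
- move=> S T; rewrite /= /tensor_ip exchange_big4 rmorph_sum /=.
  apply: eq_bigr => k _; rewrite rmorph_sum; apply: eq_bigr => l _.
  rewrite rmorph_sum; apply: eq_bigr => i _; rewrite rmorph_sum.
  apply: eq_bigr => j _; rewrite !rmorphM /= conjCK -(ip_herm Vi) -(ip_herm Wi).
  by rewrite [X in X * _]mulrC.
- move=> T T0; apply/matrixP => i j; rewrite mxE.
  have T_pure (v : V) (w : W) :
      \sum_l (\sum_k T k l * ip v (basisv k)) * ip w (basisv l) = 0.
    rewrite -[RHS](T0 (pure v w)) [in RHS](tensor_expand T).
    rewrite (@linear_sumZ (tensor V W) C^o); last exact: lin.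
    under eq_bigr do rewrite mulr_suml.
    rewrite exchange_big pair_bigA; apply: eq_bigr => -[k l] _.
    by rewrite tensor_ip_pure //= -mulrA.
  have T_col (v : V) l : \sum_k T k l * ip v (basisv k) = 0.
    apply: (@basisv_free W (fun l => \sum_k T k l * ip v (basisv k))).
    by apply: (ip_nondeg Wi) => w; rewrite (ip_sumr Wi).
  apply: (@basisv_free V (T^~ j)); apply: (ip_nondeg Vi) => v.
  by rewrite (ip_sumr Vi).
Qed.

(** Both sides are antilinear in the tensor, so pure tensors suffice; the proof
    conjugates both sides to expand in the linear argument. *)
Lemma is_adjoint_tensor (V W U : ipSpace C) (f : 'Hom(tensor V W, U))
    (g : 'Hom(U, tensor V W)) :
  is_inner V -> is_inner W -> is_inner U ->
  (forall v w u, ip (f (pure v w)) u = ip (pure v w) (g u)) -> is_adjoint f g.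
Proof.
move=> Vi Wi Ui fg T u; have VWi := tensor_inner Vi Wi.
rewrite (ip_herm Ui) [RHS](ip_herm VWi); congr _^*.
rewrite (tensor_expand T) (@linear_sumZ (tensor V W) U); last exact: linearP.
rewrite (ip_sumr Ui) (ip_sumr VWi); apply: eq_bigr => p _.
by rewrite (ip_herm Ui) fg -(ip_herm VWi).
Qed.

Lemma scalar_inner : is_inner (scalarSpace C).
Proof.
split=> [v z x y|v w|w] /=.
- by rewrite mulrDr mulrCA.
- by rewrite rmorphM /= conjCK mulrC.
- by move=> /(_ 1); rewrite rmorph1 mul1r.
Qed.

End LinearAlgebra.

(** * The quantum space of matrices *)

Section Matrices.
Variables (C : numClosedFieldType) (n : nat).
Implicit Types a b x y : 'M[C]_n.+1.

Local Notation X := (matAlg C n).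
Local Notation N := (n.+1%:R : C).

(** In the next two lemmas a matrix unit is split as a column times a row, which
    reduces the claim to one-by-one matrices. *)
Lemma trace_mul_delta a i j : \tr (a *m delta_mx i j) = a j i.
Proof.
rewrite -(mul_delta_mx (0 : 'I_1)) mulmxA mxtrace_mulC mulmxA -rowE -colE.
by rewrite /mxtrace big_ord1 !mxE.
Qed.

Lemma delta_sandwich a (i j : 'I_n.+1) :
  delta_mx j i *m a *m delta_mx i j = a i i *: delta_mx j j.
Proof.
transitivity ((delta_mx j 0 : 'cV[C]_n.+1) *m col i (row i a)
              *m (delta_mx 0 j : 'rV[C]_n.+1)).
  rewrite colE rowE -(mul_delta_mx (0 : 'I_1) i j).
  by rewrite -(mul_delta_mx (0 : 'I_1) j i) !mulmxA.
rewrite (mx11_scalar (col i (row i a))) !mxE mul_mx_scalar -scalemxAl.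
by rewrite mul_delta_mx.
Qed.

Lemma mat_ipE a b : ip (a : l2 X) b = N * \tr (map_mx Num.conj a^T *m b).
Proof. by []. Qed.

Lemma mat_ip_delta a i j : ip (a : l2 X) (delta_mx i j) = N * (a i j)^*.
Proof. by rewrite mat_ipE trace_mul_delta !mxE. Qed.

Lemma mat_ip_sum a b :
  ip (a : l2 X) b = N * \sum_i \sum_j (a i j)^* * b i j.
Proof.
rewrite mat_ipE /mxtrace exchange_big; congr (_ * _).
by apply: eq_bigr => i _; rewrite mxE; apply: eq_bigr => j _; rewrite !mxE.
Qed.

Lemma size_neq0 : N != 0. Proof. by rewrite pnatr_eq0. Qed.

Lemma l2_inner : is_inner (l2 X).
Proof.
split=> [a z x y|a b|a a0].
- by rewrite !mat_ipE linearP linearP mulrDr mulrCA.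
- rewrite !mat_ip_sum rmorphM rmorph_nat rmorph_sum; congr (_ * _).
  apply: eq_bigr => i _; rewrite rmorph_sum; apply: eq_bigr => j _ /=.
  by rewrite rmorphM /= conjCK mulrC.
- apply/matrixP => i j; rewrite [RHS]mxE.
  have /eqP := a0 (delta_mx i j); rewrite mat_ipE trmx_delta map_delta_mx.
  by rewrite mxtrace_mulC trace_mul_delta mulf_eq0 (negPf size_neq0) => /eqP.
Qed.

Lemma qmul_pure a b : qmul X (pure (a : l2 X) (b : l2 X)) = a *m b.
Proof.
rewrite /qmul tensor_lift_pure //; split=> [v|w] z x y /=.
  by rewrite mulrDr scalerAr.
by rewrite mulrDl scalerAl.
Qed.

Lemma qunitE (z : C) : qunit X z = z%:M.
Proof.
rewrite /qunit linfun_apply; first by rewrite -scalemx1.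
by move=> c x y; rewrite scalerDl scalerA.
Qed.

(** The candidate for the adjoint of the multiplication; on matrix units it is
    e_ij |-> N^-1 sum_k e_ik (x) e_kj. *)
Definition mat_comult : 'Hom(l2 X, tensor (l2 X) (l2 X)) :=
  linfun (fun a : 'M[C]_n.+1 => \sum_(p : 'I_n.+1 * 'I_n.+1)
    N^-1 *: pure (a *m delta_mx p.1 p.2 : l2 X) (delta_mx p.2 p.1 : l2 X)).

Lemma mat_comultE a : mat_comult a = \sum_(p : 'I_n.+1 * 'I_n.+1)
  N^-1 *: pure (a *m delta_mx p.1 p.2 : l2 X) (delta_mx p.2 p.1 : l2 X).
Proof.
rewrite /mat_comult linfun_apply // => z x y.
rewrite scaler_sumr -big_split; apply: eq_bigr => p _ /=.
rewrite mulmxDl -scalemxAl (pure_bilinear (l2 X) (l2 X)).2 scalerDr.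
by rewrite !scalerA mulrC.
Qed.

(** On x (x) y the right-hand side is
    N^-1 sum_(p,k) N Tr(x^* a e_pk) N Tr(y^* e_kp), and the traces against
    matrix units are the entries that make up the trace form N Tr(y^* x^* a) of
    the left-hand side. *)
Lemma qmul_adjoint : is_adjoint (qmul X) mat_comult.
Proof.
have Xi := l2_inner.
apply: is_adjoint_tensor => // x y a.
rewrite qmul_pure mat_comultE (ip_sumr (tensor_inner Xi Xi)).
rewrite mat_ipE trmx_mul map_mxM -mulmxA /mxtrace mulr_sumr.
under eq_bigr do rewrite mxE mulr_sumr.
rewrite pair_bigA; apply: eq_bigr => -[i j] _.
rewrite tensor_ip_pure // mat_ip_delta mat_ipE mulmxA trace_mul_delta !mxE /=.
by rewrite !mulrA mulVf ?size_neq0 // mul1r -!mulrA [RHS]mulrC -mulrA.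
Qed.

Lemma adj_qmul : adj (qmul X) = mat_comult.
Proof. by apply: adj_eq qmul_adjoint; apply: tensor_inner l2_inner l2_inner. Qed.

Definition mat_counit_hom : 'Hom(l2 X, scalarSpace C) :=
  linfun (@mat_counit C n : 'M[C]_n.+1 -> C^o).

Lemma mat_counit_homE a : mat_counit_hom a = N * \tr a.
Proof.
by rewrite /mat_counit_hom linfun_apply //; apply: mat_counit_is_scalar.
Qed.

Lemma qunit_adjoint : is_adjoint (qunit X) mat_counit_hom.
Proof.
move=> z a; rewrite qunitE mat_counit_homE mat_ipE tr_scalar_mx map_scalar_mx.
by rewrite mul_scalar_mx linearZ mulrCA.
Qed.

Lemma adj_qunit : adj (qunit X) = mat_counit_hom.
Proof. exact: adj_eq (scalar_inner C) qunit_adjoint. Qed.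

Lemma mat_delta2 : delta2 X = N ^+ 2.
Proof.
by rewrite /delta2 adj_qunit comp_lfunE qunitE mat_counit_homE mxtrace_scalar.
Qed.

(** R^dagger = eta^dagger m, since m is in turn the adjoint of m^dagger. *)
Lemma adj_qR : adj (qR X) = (mat_counit_hom \o qmul X)%VF.
Proof.
have Xi := l2_inner; have XXi := tensor_inner Xi Xi.
apply: adj_eq; first exact: scalar_inner.
rewrite /qR adj_qmul; apply: is_adjoint_comp qunit_adjoint _.
exact: is_adjoint_sym qmul_adjoint.
Qed.

(** Non-degeneracy of (a, b) |-> psi(a b) in the second argument follows from
    that of the inner product because the star is onto; in the first argument,
    from the trace property. *)
Lemma mat_quantum_space : is_finite_quantum_space X.
Proof.
have nondegr (b : 'M[C]_n.+1) : (forall a, mat_counit (a *m b) = 0) -> b = 0.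
  by move=> b0; apply: (ip_nondeg l2_inner) => a; apply: b0.
split=> /=.
- by move=> z a b; apply/matrixP => i j; rewrite !mxE rmorphD rmorphM.
- by move=> a; apply/matrixP => i j; rewrite !mxE conjCK.
- by move=> a b; rewrite trmx_mul map_mxM.
- move=> a; have := mat_ip_sum a a; rewrite /= => ->.
  rewrite mulr_ge0 ?ler0n // sumr_ge0 // => i _; rewrite sumr_ge0 // => j _.
  by rewrite mulrC mul_conjC_ge0.
- move=> a a0; apply: nondegr => b; rewrite -[RHS](a0 b) /mat_counit.
  by rewrite mxtrace_mulC.
- by move=> b b0; apply: nondegr => a; apply: b0.
- apply/lfunP => a; rewrite comp_lfunE id_lfunE adj_qmul mat_comultE lfun_sumZ.
  transitivity (\sum_i \sum_(j < n.+1) N^-1 *: (a *m delta_mx i i)).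
    rewrite pair_bigA; apply: eq_bigr => -[i j] _ /=.
    by rewrite qmul_pure -mulmxA mul_delta_mx.
  rewrite -[RHS](mulmx1 (a : 'M[C]_n.+1)) mx1_sum_delta mulmx_sumr.
  apply: eq_bigr => i _; rewrite sumr_const card_ord -scaler_nat scalerA.
  by rewrite divff ?size_neq0 // scale1r.
Qed.

(** * Multiples of the transposition *)

Definition mat_tr (c : C) : 'Hom(l2 X, l2 X) :=
  linfun (fun a : 'M[C]_n.+1 => c *: a^T).

Lemma mat_trE c a : mat_tr c a = c *: a^T.
Proof.
rewrite /mat_tr linfun_apply // => z x y.
by rewrite linearP scalerDr !scalerA mulrC.
Qed.

Lemma adj_mat_tr c : c^* = c -> adj (mat_tr c) = mat_tr c.
Proof.
move=> cR; apply: adj_eq l2_inner _ => a b; rewrite !mat_trE !mat_ip_sum.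
rewrite exchange_big; congr (_ * _); apply: eq_bigr => i _; apply: eq_bigr => j _.
by rewrite !mxE rmorphM /= cR mulrCA mulrA.
Qed.

(** The map A^* sends a to the contraction [G] of R(1) (x) a. On a summand
    x (x) y of R(1) it yields c N Tr(a y^T) x; for x = e_ij and y = e_ji this
    picks out the coefficient a_ji of e_ij in a^T. *)
Lemma qconj_mat_tr c : c^* = c -> qconj (mat_tr c) = mat_tr c.
Proof.
move=> cR; apply/lfunP => a; rewrite mat_trE /qconj.
rewrite !comp_lfunE tensor_lunit_invE tensor_map_pure id_lfunE (adj_mat_tr cR).
pose G (S : tensor (l2 X) (l2 X)) : 'M[C]_n.+1 :=
  tensor_runit (l2 X) (tensor_map \1%VF (adj (qR X))
   (tensor_assoc (l2 X) (l2 X) (l2 X)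
     (tensor_map (tensor_map \1%VF (mat_tr c)) \1%VF (pure S (a : l2 X))))).
have GL : linear G.
  by move=> z S T; rewrite /G (pure_bilinear _ _).2 !linearP.
have GE x y : G (pure (x : l2 X) (y : l2 X)) = (c * N * \tr (a *m y^T)) *: x.
  rewrite /G tensor_map_pure tensor_map_pure tensor_assoc_pure tensor_map_pure.
  rewrite !id_lfunE adj_qR comp_lfunE qmul_pure mat_counit_homE tensor_runit_pure.
  by rewrite mat_trE -scalemxAl linearZ /= mxtrace_mulC mulrCA mulrA.
rewrite -[LHS]/(G (qR X 1)) /qR comp_lfunE adj_qmul qunitE mat_comultE.
rewrite (linear_sumZ _ _ _ GL) [in RHS](matrix_sum_delta a^T) pair_bigA.
rewrite scaler_sumr.
apply: eq_bigr => -[i j] _ /=; rewrite GE mul1mx trmx_delta trace_mul_delta mxE.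
by rewrite !scalerA (mulrC c) mulrA mulrA mulVf ?size_neq0 // mul1r mulrC.
Qed.

(** The factor N^-2 is N^-1 from the comultiplication and N^-1 from comparing
    Tr(a) 1 with eta eta^dagger(a) = N Tr(a) 1. *)
Lemma schur_mat_tr c d : schur (mat_tr c) (mat_tr d)
  = (N^-2 * c * d) *: (qunit X \o adj (qunit X))%VF.
Proof.
apply/lfunP => a; rewrite /schur scale_lfunE !comp_lfunE adj_qunit.
rewrite adj_qmul mat_comultE !lfun_sumZ mat_counit_homE qunitE.
transitivity
  (\sum_i \sum_j (N^-1 * c * d * a i i) *: (delta_mx j j : 'M[C]_n.+1)).
  rewrite pair_bigA; apply: eq_bigr => -[i j] _.
  rewrite tensor_map_pure qmul_pure !mat_trE trmx_mul !trmx_delta.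
  by rewrite -scalemxAl -scalemxAr delta_sandwich mxE !scalerA.
under eq_bigr do rewrite -scaler_sumr -mx1_sum_delta.
rewrite -scaler_suml -mulr_sumr.
have NN : N^-1 * c * d = N^-2 * c * d * N.
  rewrite [RHS]mulrC !mulrA; congr (_ * _ * _).
  by rewrite expr2 invfM mulVKf ?size_neq0.
transitivity ((N^-2 * c * d * (N * \tr a)) *: (1%:M : 'M[C]_n.+1)).
  by rewrite mulrA -NN.
by rewrite -scalerA scalemx1.
Qed.

Lemma mat_tr_qHadamard : is_qHadamard (mat_tr N).
Proof.
have NR : N^* = N by rewrite rmorph_nat.
have HH : (mat_tr N \o mat_tr N)%VF = delta2 X *: \1%VF.
  apply/lfunP => a; rewrite comp_lfunE !mat_trE scale_lfunE id_lfunE.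
  by rewrite linearZ /= trmxK scalerA mat_delta2.
split; rewrite ?adj_mat_tr ?qconj_mat_tr ?HH //.
by rewrite schur_mat_tr -mulrA -expr2 mulVf ?scale1r // expf_neq0 ?size_neq0.
Qed.

Lemma mat_tr_normalized :
  is_normalized_qHadamard (linfun (@trmx C n.+1 n.+1) : 'Hom(l2 X, l2 X)).
Proof.
exists (mat_tr N); first exact: mat_tr_qHadamard.
apply/lfunP => a; rewrite scale_lfunE mat_trE lfunE mat_delta2 sqrCK ?ler0n //.
by rewrite scalerA mulVf ?size_neq0 // scale1r.
Qed.

End Matrices.

Theorem mainTheorem3 (R : realType) (n : nat) :
  let X := matAlg R[i] n in
  [/\ is_finite_quantum_space X,
      (forall a : 'M[R[i]]_n.+1, adj (qunit X) a = n.+1%:R * \tr a),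
      delta2 X = n.+1%:R ^+ 2,
      is_normalized_qHadamard (linfun (@trmx R[i] n.+1 n.+1) : 'Hom(l2 X, l2 X)) &
      is_qHadamard
        (linfun (fun a : 'M[R[i]]_n.+1 => n.+1%:R *: a^T) : 'Hom(l2 X, l2 X))].
Proof.
split.
- exact: mat_quantum_space.
- by move=> a; rewrite adj_qunit mat_counit_homE.
- exact: mat_delta2.
- exact: mat_tr_normalized.
- exact: mat_tr_qHadamard.
Qed.
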